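(* Let $\Omega$ be a Polish space and $T\in\mathscr{L}(\mathscr{M}(\Omega),\sigma)$ with transition kernel $k$ such that $k(x,\cdot)$ is a probability measure for every $x\in\Omega$ and the measures $k(x,\cdot)$, $k(y,\cdot)$ are equivalent for all $x,y\in\Omega$. If there exists a probability measure $\mu$ with $T\mu=\mu$, then $\lim_{n\to\infty}T^n\nu=\nu(\Omega)\,\mu$ in the total variation norm for every $\nu\in\mathscr{M}(\Omega)$.
   Context: $\mathscr{M}(\Omega)$: finite signed Borel measures with total variation norm. $T$ is weakly continuous with kernel $k$ if $k:\Omega\times\mathscr{B}(\Omega)\to\mathbb{R}$ is a bounded transition kernel (signed measure in the second variable, Borel measurable in the first, $\sup_x\lvert k\rvert(x,\Omega)<\infty$) and $(T\mu)(A)=\int k(x,A)\,d\mu(x)$; $\mathscr{L}(\mathscr{M}(\Omega),\sigma)$ is the space of such operators. Two measures are equivalent if they are mutually absolutely continuous. *)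

(* Defs.v *)
From HB Require Import structures.
From mathcomp Require Import all_boot all_order all_algebra.
From mathcomp Require Import all_classical all_reals all_analysis measurable_realfun.
Set Implicit Arguments.
Unset Strict Implicit.
Unset Printing Implicit Defensive.
Import Order.TTheory GRing.Theory Num.Theory.
Import numFieldNormedType.Exports.
Local Open Scope classical_set_scope.
Local Open Scope ring_scope.

Definition separable_space (T : topologicalType) : Prop :=
  exists D : set T, countable D /\ closure D = setT.

Definition completely_metrizable (R : realType) (T : topologicalType) : Prop :=
  exists dist : T -> T -> R,
    [/\ (forall x y, 0 <= dist x y),
        (forall x y, dist x y = 0 <-> x = y),
        (forall x y, dist x y = dist y x) /\
        (forall x y z, dist x z <= dist x y + dist y z),
        (forall A : set T, open A <->
           (forall x, A x -> exists2 e : R, 0 < e & [set y | dist x y < e] `<=` A))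
      & (forall u : nat -> T,
           (forall e : R, 0 < e -> exists N : nat, forall m n : nat,
              (N <= m)%N -> (N <= n)%N -> dist (u m) (u n) < e) ->
           exists l : T, u @ \oo --> l)].

Definition polish_space (R : realType) (T : topologicalType) : Prop :=
  separable_space T /\ completely_metrizable R T.

Notation borel T := (g_sigma_algebraType (@open T)).

Local Open Scope ereal_scope.

Definition tv_norm d (T : measurableType d) (R : realType) (nu : set T -> \bar R)
  : \bar R :=
  ereal_sup [set s | exists (n : nat) (A : nat -> set T),
     [/\ (forall i, measurable (A i)), trivIset setT A &
         s = \sum_(i < n) `| nu (A i) |] ].

Definition jordan_decomposition d (T : measurableType d) (R : realType)
  (nu : {charge set T -> \bar R}) (m1 m2 : {finite_measure set T -> \bar R}) :=
  (forall A, measurable A -> nu A = m1 A - m2 A) /\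
  exists2 P : set T, measurable P & m1 (~` P) = 0 /\ m2 P = 0.

Definition signed_integral d (T : measurableType d) (R : realType)
  (nu : {charge set T -> \bar R}) (f : T -> \bar R) (v : \bar R) :=
  exists m1 m2 : {finite_measure set T -> \bar R},
    jordan_decomposition nu m1 m2 /\
    v = \int[m1]_x f x - \int[m2]_x f x.

Definition bounded_transition_kernel d (T : measurableType d) (R : realType)
  (k : T -> {charge set T -> \bar R}) :=
  (forall A, measurable A -> measurable_fun [set: T] (fun x : T => (k x A : \bar R))) /\
  exists M : R, forall x, tv_norm (k x) <= M%:E.

Definition weakly_continuous_with_kernel d (T : measurableType d) (R : realType)
  (Top : {charge set T -> \bar R} -> {charge set T -> \bar R})
  (k : T -> {charge set T -> \bar R}) :=
  bounded_transition_kernel k /\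
  forall (nu : {charge set T -> \bar R}) A, measurable A ->
    signed_integral nu (fun x => k x A) (Top nu A).

(* Main.v *)
(** Write [rho_n = T^n nu - nu(Omega) mu]; these charges have total mass [0] and
    [rho_(n+1)] is the image of [rho_n] under the kernel.  All [k x] are
    equivalent to [mu], and this is uniform outside a small set of points: for
    [a > 0] there is [dl > 0] such that [mu C >= 1/2] implies
    [mu {x | k x C < dl} <= a].  Otherwise there are sets [C_n] for which
    [{x | k x (C_n) < 1/(n+1)}] has measure at least [a]; a point [x] lying in
    infinitely many of these sets contradicts [mu << k x].
    As one of [mu C], [mu (~C)] is at least [1/2], a fixed proportion [dl] of the
    positive or of the negative part of [rho_n] is cancelled in the next step,
    up to what these parts put on a set of [mu]-measure at most [a].  This error
    is small uniformly in [n], because a bound [|rho A| <= c mu A + e] passes from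
    [rho_1] (which is absolutely continuous with respect to [mu]) to all [rho_n].
    Hence [sup rho_(n+1) <= (1 - dl) sup rho_n + dl eps]. *)
Require Import Defs.
From HB Require Import structures.
From mathcomp Require Import all_boot all_order all_algebra.
From mathcomp Require Import all_classical all_reals all_analysis measurable_realfun.
From mathcomp Require Import lra.
Import Order.TTheory GRing.Theory Num.Theory.
Import numFieldNormedType.Exports.
Local Open Scope classical_set_scope.
Local Open Scope ring_scope.

(** * Charges: Jordan decomposition, integrals and total variation *)

Section charges.
Set Implicit Arguments.
Unset Strict Implicit.
Context {d : measure_display} {T : measurableType d} {R : realType}.
Implicit Types (m : {finite_measure set T -> \bar R})
  (rho : {charge set T -> \bar R}) (f : T -> \bar R).
Local Open Scope ereal_scope.

Lemma charge_abs_continuous rho (mu : {measure set T -> \bar R}) :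
  (forall A, measurable A -> mu A = 0 -> rho A = 0) ->
  forall e : R, (0 < e)%R -> exists2 dl : R, (0 < dl)%R &
    forall A, measurable A -> mu A < dl%:E -> `|rho A| < e%:E.
Proof.
move=> rho0 e e0; have [P [N PN]] := Hahn_decomposition rho.
have rhomu : rho `<< mu.
  by apply/null_content_dominatesP => A mA; exact: rho0.
have [dl [dl0 H]] := charge_variation_continuous PN rhomu e0.
exists dl => // A mA /(H _ mA); apply: le_lt_trans.
exact: abse_charge_variation.
Qed.

Lemma jordan_decomposition_exists rho :
  exists m1 m2, jordan_decomposition rho m1 m2.
Proof.
have [P [N PN]] := Hahn_decomposition rho.
exists (jordan_pos PN), (jordan_neg PN); split.
  by move=> A mA; rewrite (jordan_decomp PN mA)/= /cadd/= cscaleN1.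
have [[mP _] [mN _] PNT PN0] := PN; exists P => //; split.
  rewrite /= jordan_posE cjordan_posE /crestr0 mem_set ?/crestr; last exact: measurableC.
  by rewrite setICl charge0.
rewrite /= jordan_negE cjordan_negE /crestr0 mem_set// /crestr.
by rewrite PN0 charge0 oppe0.
Qed.

(** Since [m1] is carried by [P] and [m2] by its complement, restricting [rho] to either set
    isolates one of them. Every pair satisfying [jordan_decomposition] is thus read off from [rho]
    itself. *)
Lemma jordan_decompositionE rho m1 m2 : jordan_decomposition rho m1 m2 ->
  exists2 P, measurable P & forall A, measurable A ->
    m1 A = rho (A `&` P) /\ m2 A = - rho (A `\` P).
Proof.
move=> [H [P mP [m1P m2P]]]; exists P => // A mA.
have m1D : m1 (A `\` P) = 0.
  apply/eqP; rewrite eq_le measure_ge0 andbT -m1P le_measure ?inE//.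
  - exact: measurableD.
  - exact: measurableC.
have m2I : m2 (A `&` P) = 0.
  apply/eqP; rewrite eq_le measure_ge0 andbT -m2P le_measure ?inE//.
  exact: measurableI.
rewrite !H; [|exact: measurableD|exact: measurableI].
have mDI (m : {finite_measure set T -> \bar R}) :
    m A = m (A `\` P) + m (A `&` P) by exact: measureDI.
by rewrite (mDI m1) (mDI m2) m1D m2I add0e adde0 sube0 sub0e oppeK.
Qed.

Lemma integral_le_mass m f : measurable_fun setT f ->
  (forall x, 0 <= f x <= 1) -> \int[m]_x f x <= m setT.
Proof.
move=> mf f01; have f0 x : 0 <= f x by case/andP: (f01 x).
apply: (@le_trans _ _ (\int[m]_x cst 1 x)).
  by apply: ge0_le_integral => // x _; case/andP: (f01 x).
by rewrite integral_cst// mul1e.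
Qed.

Lemma integral_fin_num m f : measurable_fun setT f ->
  (forall x, 0 <= f x <= 1) -> \int[m]_x f x \is a fin_num.
Proof.
move=> mf f01; have f0 x : 0 <= f x by case/andP: (f01 x).
rewrite ge0_fin_numE; last exact: integral_ge0.
apply: le_lt_trans (integral_le_mass m mf f01) _.
by rewrite -ge0_fin_numE// fin_num_measure.
Qed.

(** The error stays [e] because [m1] is dominated by [m2] plus the positive part [p] of [m1 - m2].
    The mass of [p] is the value of [m1 - m2] on a single set, hence at most [e], and [f] is bounded
    by [1]. *)
Lemma integral_le_add (m1 m2 : {finite_measure set T -> \bar R}) (e : R) f :
  (forall A, measurable A -> m1 A <= m2 A + e%:E) ->
  measurable_fun setT f -> (forall x, 0 <= f x <= 1) ->
  \int[m1]_x f x <= \int[m2]_x f x + e%:E.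
Proof.
move=> H mf f01; have f0 x : 0 <= f x by case/andP: (f01 x).
pose s : {charge set T -> \bar R} :=
  cadd (charge_of_finite_measure m1) (cscale (-1) (charge_of_finite_measure m2)).
have sE A : s A = m1 A - m2 A.
  by change (m1 A + (-1)%:E * m2 A = m1 A - m2 A); rewrite EFinN mulN1e.
have [p [n jpn]] := jordan_decomposition_exists s.
have [P mP PE] := jordan_decompositionE jpn.
have m12 A : measurable A -> m1 A <= measure_add m2 p A.
  move=> mA; rewrite measure_addE addeC -leeBlDr ?fin_num_measure// -sE.
  by rewrite (jpn.1 _ mA) leeBlDr ?fin_num_measure// leeDl.
apply: (@le_trans _ _ (\int[measure_add m2 p]_x f x)).
  exact: ge0_le_measure_integral.
rewrite ge0_integral_measure_add// leeD2l// (le_trans (integral_le_mass _ mf f01))//.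
rewrite (PE _ measurableT).1 setTI sE leeBlDl ?fin_num_measure//.
exact: H.
Qed.

(** The Jordan parts of the difference are not differences of the given parts. Moving all negative
    terms to the other side gives an equality between two finite measures, which can be integrated
    and rearranged, every integral being finite. *)
Lemma signed_integral_sub rho m (t : R) f v :
  measurable_fun setT f -> (forall x, 0 <= f x <= 1) ->
  signed_integral rho f v ->
  signed_integral (cadd rho (cscale (- t) (charge_of_finite_measure m))) f
    (v - t%:E * \int[m]_x f x).
Proof.
move=> mf f01 [m1 [m2 [j12 ->]]]; have f0 x : 0 <= f x by case/andP: (f01 x).
set rho' := cadd _ _.
have [p [n jpn]] := jordan_decomposition_exists rho'.
exists p, n; split => //.
(* [t] has arbitrary sign, so its positive and negative parts are kept on opposite sides of the
   equality of measures. *)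
have tp0 : (0 <= Num.max t 0)%R by rewrite le_max lexx orbT.
have tn0 : (0 <= Num.max (- t) 0)%R by rewrite le_max lexx orbT.
pose tp := NngNum tp0; pose tn := NngNum tn0.
have tE : t = (tp%:num - tn%:num)%R by rewrite /= /Num.max; case: ifP; case: ifP; lra.
have : \int[measure_add (measure_add m1 n) (mscale tn m)]_x f x =
    \int[measure_add (measure_add m2 p) (mscale tp m)]_x f x.
  apply: eq_measure_integral => A mA _.
  suff : m1 A + n A + tn%:num%:E * m A = m2 A + p A + tp%:num%:E * m A.
    have addE (a b : {measure set T -> \bar R}) : measure_add a b A = a A + b A.
      exact: measure_addE.
    move=> h; rewrite [LHS]addE [RHS]addE.
    by rewrite [X in X + _ = _]addE [X in _ = X + _]addE.
  have : rho A + (- t)%:E * m A = p A - n A by exact: jpn.1.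
  rewrite (j12.1 _ mA) {1}tE.
  rewrite -(fineK (fin_num_measure m A mA)) -(fineK (fin_num_measure m1 A mA)).
  rewrite -(fineK (fin_num_measure m2 A mA)) -(fineK (fin_num_measure p A mA)).
  rewrite -(fineK (fin_num_measure n A mA)).
  rewrite -!(EFinM, EFinN, EFinD) => -[h]; congr EFin.
  by move: h; set x := fine _; rewrite /=; lra.
rewrite !ge0_integral_measure_add// !ge0_integral_mscale//.
have F m' : \int[m']_x f x = (fine (\int[m']_x f x))%:E.
  by rewrite fineK// integral_fin_num.
rewrite (F m) (F m1) (F m2) (F p) (F n) {1}tE.
rewrite -!(EFinM, EFinN, EFinD) => -[h]; congr EFin.
by move: h; rewrite /=; lra.
Qed.

Lemma jordan_decomposition_abse rho m1 m2 A :
  jordan_decomposition rho m1 m2 -> measurable A -> `|rho A| <= m1 A + m2 A.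
Proof.
move=> [H _] mA; rewrite (H _ mA); apply: (le_trans (lee_abs_sub _ _)).
by rewrite !gee0_abs.
Qed.

Lemma tv_norm_ge0 rho : 0 <= tv_norm rho.
Proof.
apply: ereal_sup_ubound; exists 0%N, (fun=> set0); split => //.
  exact: trivIset_set0.
by rewrite big_ord0.
Qed.

(** Total mass [0] gives both Jordan parts the same mass, and that of the positive part is a value
    of [rho]; hence the factor [2] from a one-sided bound. *)
Lemma tv_norm_le rho (v : R) : rho setT = 0 ->
  (forall A, measurable A -> rho A <= v%:E) -> tv_norm rho <= (2 * v)%:E.
Proof.
move=> rhoT rhov; have [m1 [m2 j12]] := jordan_decomposition_exists rho.
have [P mP PE] := jordan_decompositionE j12.
have m1v : m1 setT <= v%:E.
  by rewrite (PE _ measurableT).1 setTI; exact: rhov.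
have m2v : m2 setT <= v%:E.
  have : rho setT = m1 setT - m2 setT by exact: j12.1.
  rewrite rhoT => /esym/eqP; rewrite sube_eq ?fin_num_adde_defl ?fin_num_measure//.
  by rewrite add0e => /eqP <-.
apply: ge_ereal_sup => _ [n [A [mA tA ->]]].
apply: (@le_trans _ _ (\sum_(i < n) (m1 (A i) + m2 (A i)))).
  by apply: lee_sum => i _; exact: jordan_decomposition_abse.
rewrite big_split/=.
have sumle m : \sum_(i < n) m (A i) <= m setT.
  rewrite -measure_semi_additive_ord//; last 2 first.
  - by move=> i j _ _ /(tA _ _ I I) ij; exact: val_inj.
  - exact: bigsetU_measurable.
  by rewrite le_measure ?inE//; exact: bigsetU_measurable.
rewrite mulr_natl mulr2n EFinD; apply: leeD.
  exact: le_trans (sumle m1) m1v.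
exact: le_trans (sumle m2) m2v.
Qed.

(** Absolute continuity gives a threshold [dl]: below it the term [e] suffices, and above it
    [c = V / dl] makes [c * m A] exceed the total variation [V]. *)
Lemma charge_le_scale_add rho m (e : R) : (0 < e)%R ->
  (forall A, measurable A -> m A = 0 -> rho A = 0) ->
  exists c : {nonneg R}, forall A, measurable A ->
    `|rho A| <= c%:num%:E * m A + e%:E.
Proof.
move=> e0 /charge_abs_continuous/(_ _ e0)[dl dl0 H].
have [m1 [m2 j12]] := jordan_decomposition_exists rho.
pose V := (fine (m1 setT) + fine (m2 setT))%R.
have c0 : (0 <= V / dl)%R.
  by rewrite divr_ge0 ?addr_ge0 ?fine_ge0// ltW.
exists (NngNum c0) => A mA /=; have [/(H _ mA)/ltW h|dlm] := ltP (m A) dl%:E.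
  by apply: (le_trans h); rewrite leeDr// mule_ge0.
apply: (@le_trans _ _ ((V / dl)%:E * m A)); last by rewrite leeDl// lee_fin ltW.
apply: (@le_trans _ _ V%:E).
  apply: (le_trans (jordan_decomposition_abse j12 mA)).
  rewrite /V EFinD !fineK ?fin_num_measure//.
  by apply: leeD; rewrite le_measure ?inE.
apply: (@le_trans _ _ ((V / dl)%:E * dl%:E)).
  by rewrite -EFinM divfK// gt_eqF.
by rewrite lee_wpmul2l.
Qed.

Lemma charge_bounded rho : exists V : R, (0 <= V)%R /\
  forall A, measurable A -> rho A <= V%:E.
Proof.
have [m1 [m2 j12]] := jordan_decomposition_exists rho.
exists (fine (m1 setT) + fine (m2 setT))%R.
split=> [|A mA]; first by rewrite addr_ge0// fine_ge0.
apply: (le_trans (lee_abs _)); apply: (le_trans (jordan_decomposition_abse j12 mA)).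
rewrite EFinD !fineK ?fin_num_measure//.
by apply: leeD; rewrite le_measure ?inE.
Qed.

Lemma jordan_decomposition_ge0 rho m1 m2 :
  (forall A, measurable A -> 0 <= rho A) -> jordan_decomposition rho m1 m2 ->
  forall A, measurable A -> m1 A = rho A /\ m2 A = 0.
Proof.
move=> rho0 j12 A mA; have [P mP PE] := jordan_decompositionE j12.
have m20 : m2 A = 0.
  apply/eqP; rewrite eq_le measure_ge0 andbT (PE _ mA).2 oppe_le0.
  by apply: rho0; exact: measurableD.
by rewrite (j12.1 _ mA) m20 sube0.
Qed.

Lemma finite_measure_of_charge rho : (forall A, measurable A -> 0 <= rho A) ->
  exists m, forall A, measurable A -> m A = rho A.
Proof.
move=> rho0; have [m1 [m2 j12]] := jordan_decomposition_exists rho.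
by exists m1 => A mA; have [] := jordan_decomposition_ge0 rho0 j12 mA.
Qed.

(** The tail unions decrease to the limsup and each has measure at least [a]; finiteness of [m]
    gives continuity from above. *)
Lemma lim_sup_set_measure_ge m (E : (set T)^nat) (a : \bar R) :
  (forall n, measurable (E n)) -> (forall n, a <= m (E n)) ->
  a <= m (lim_sup_set E).
Proof.
move=> mE aE.
have mU n : measurable (\bigcup_(j >= n) E j) by exact: bigcup_measurable.
have /(_ _ _)/cvg_lim <-// := lim_sup_set_cvg m E.
  apply: lime_ge.
    apply: ereal_nonincreasing_is_cvgn => i j ij.
    rewrite le_measure ?inE//.
    by apply: bigcup_subset => n/=; exact: leq_trans.
  apply: nearW => k; apply: le_trans (aE k) _.
  by rewrite le_measure ?inE//; apply: bigcup_sup => /=.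
by rewrite -ge0_fin_numE// fin_num_measure.
Qed.

Lemma jordan_decomposition_le rho m1 m2 m (c : {nonneg R}) (e : R) :
  jordan_decomposition rho m1 m2 ->
  (forall A, measurable A -> `|rho A| <= c%:num%:E * m A + e%:E) ->
  forall A, measurable A ->
    m1 A <= c%:num%:E * m A + e%:E /\ m2 A <= c%:num%:E * m A + e%:E.
Proof.
move=> /jordan_decompositionE[P mP PE] H A mA.
have mI : measurable (A `&` P) by exact: measurableI.
have mD : measurable (A `\` P) by exact: measurableD.
have [-> ->] := PE _ mA; split.
  apply: le_trans (lee_abs _) _; apply: (le_trans (H _ mI)).
  by rewrite leeD2r// lee_wpmul2l// le_measure ?inE.
apply: le_trans (lee_abs _) _; rewrite abseN; apply: (le_trans (H _ mD)).
by rewrite leeD2r// lee_wpmul2l// le_measure ?inE.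
Qed.

End charges.

(** * Contraction for a Markov kernel with equivalent transition probabilities *)

Section kernel.
Set Implicit Arguments.
Unset Strict Implicit.
Context {d : measure_display} {T : measurableType d} {R : realType}.
Variables (q : T -> {finite_measure set T -> \bar R}) (mu : probability T R).
Hypothesis measurable_q : forall A, measurable A ->
  measurable_fun setT (fun x => q x A : \bar R).
Hypothesis qT : forall x, q x setT = 1%E.
Hypothesis mu_equiv_q : forall x A, measurable A -> mu A = 0%E <-> q x A = 0%E.
Hypothesis mu_invariant : forall A, measurable A -> (\int[mu]_x q x A)%E = mu A.
Implicit Types (m : {finite_measure set T -> \bar R})
  (rho : {charge set T -> \bar R}).
Local Open Scope ereal_scope.

Let q01 A : measurable A -> forall x, 0 <= q x A <= 1.
Proof.
by move=> mA x; rewrite measure_ge0 -(qT x) le_measure ?inE.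
Qed.

Let measurable_q_lt C (dl : R) : measurable C ->
  measurable [set x | q x C < dl%:E].
Proof.
move=> mC; rewrite -[X in measurable X]setTI.
exact: emeasurable_fun_infty_o measurableT (measurable_q mC) _.
Qed.

Lemma kernel_minorization (a : R) : (0 < a)%R ->
  exists2 dl : R, (0 < dl <= 1)%R & forall C, measurable C ->
    (2^-1)%:E <= mu C -> mu [set x | q x C < dl%:E] <= a%:E.
Proof.
move=> a0; apply: contrapT => /forall2NP H.
have {H} : forall n : nat, exists C, [/\ measurable C, (2^-1)%:E <= mu C &
    a%:E <= mu [set x | q x C < (n.+1%:R^-1)%:E]].
  move=> n; have [|/existsNP[C /not_implyP[mC /not_implyP[muC]]]] := H n.+1%:R^-1%R.
    by rewrite invr_gt0 ltr0n/= invf_le1 ?ltr0n// ler1n.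
  by move=> /negP; rewrite -ltNge => /ltW ?; exists C.
move=> /choice[C HC].
have mC n : measurable (C n) by have [] := HC n.
pose E n := [set x | q x (C n) < (n.+1%:R^-1)%:E].
have : a%:E <= mu (lim_sup_set E).
  apply: lim_sup_set_measure_ge => n; first exact: measurable_q_lt.
  by have [] := HC n.
(* The limsup has measure at least [a > 0], so it contains a point [x]; absolute continuity of [mu]
   with respect to this single [q x] is then violated by some [C j]. *)
have [[x Ex] _|E0] := pselect (exists x, lim_sup_set E x); last first.
  have -> : lim_sup_set E = set0.
    by apply/seteqP; split => // x Ex; apply: E0; exists x.
  by rewrite measure0 lee_fin leNgt a0.
have [dl dl0 H] : exists2 dl : R, (0 < dl)%R & forall A, measurable A ->
    q x A < dl%:E -> `|charge_of_finite_measure mu A| < (2^-1)%:E.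
  apply: charge_abs_continuous; last by rewrite invr_gt0.
  by move=> A mA /(mu_equiv_q x mA).
have [n ndl] : exists n : nat, (n.+1%:R^-1 < dl)%R.
  have [n _ /(_ n (leqnn n)) ?] := near_infty_natSinv_lt (PosNum dl0).
  by exists n.
have [j /= nj Ej] := Ex n I.
have [_ + _] := HC j.
have : `|charge_of_finite_measure mu (C j)| < (2^-1)%:E.
  apply: H => //; apply: lt_trans Ej _; rewrite lte_fin.
  by apply: le_lt_trans ndl; rewrite lef_pV2 ?posrE ?ltr0n// ler_nat.
by rewrite gee0_abs// => lt_half /le_lt_trans /(_ lt_half); rewrite ltxx.
Qed.

(** Off the exceptional set the integrand is at least [dl], and [m] gives that set mass at most
    [c * a + e]. *)
Lemma integral_kernel_ge m (c : {nonneg R}) (a e dl : R) C :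
  (0 <= dl)%R ->
  (forall A, measurable A -> m A <= c%:num%:E * mu A + e%:E) ->
  measurable C -> mu [set x | q x C < dl%:E] <= a%:E ->
  dl%:E * (m setT - (c%:num * a + e)%:E) <= \int[m]_x q x C.
Proof.
move=> dl0 mle mC mua.
set D := [set x | q x C < dl%:E] in mua.
have mD : measurable D by exact: measurable_q_lt.
have mDC : measurable (~` D) by exact: measurableC.
apply: (@le_trans _ _ (\int[m]_(x in ~` D) q x C)); last first.
  by apply: ge0_subset_integral => //; exact: measurable_q.
apply: (@le_trans _ _ (\int[m]_(x in ~` D) cst dl%:E x)); last first.
  apply: ge0_le_integral => //.
    by apply: measurable_funTS; exact: measurable_q.
  by move=> x /= /negP; rewrite -leNgt.
rewrite integral_cst// lee_wpmul2l ?lee_fin//.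
have -> : m setT = m D + m (~` D) by rewrite -measureU ?setUv ?setICr.
have : m D <= (c%:num * a + e)%:E.
  apply: (le_trans (mle _ mD)).
  by rewrite EFinD EFinM leeD2r// lee_wpmul2l.
by move=> mDle; rewrite leeBlDr// addeC leeD2l.
Qed.

(** One step of the operator, as a relation: [signed_integral] only asserts that some Jordan
    decomposition yields the value, and the image is prescribed on measurable sets alone. *)
Definition kernel_image rho rho' := forall A, measurable A ->
  signed_integral rho (fun x => q x A) (rho' A).

(** Both Jordan parts inherit the bound. Integrating [q x A] reproduces [c * mu A] by invariance of
    [mu] and does not enlarge [e] because [q x A <= 1]. The new value is a difference of two numbers
    between [0] and the bound. *)
Lemma kernel_image_le rho rho' (c : {nonneg R}) (e : R) :
  kernel_image rho rho' ->
  (forall A, measurable A -> `|rho A| <= c%:num%:E * mu A + e%:E) ->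
  (forall A, measurable A -> `|rho' A| <= c%:num%:E * mu A + e%:E).
Proof.
move=> im H A mA; have [m1 [m2 [j12 ->]]] := im A mA.
have mle := jordan_decomposition_le j12 H.
have Ile m : (forall B, measurable B -> m B <= c%:num%:E * mu B + e%:E) ->
    \int[m]_x q x A <= c%:num%:E * mu A + e%:E.
  move=> mB; rewrite -(mu_invariant mA) -ge0_integral_mscale//; last exact: measurable_q.
  by apply: integral_le_add => //; [exact: measurable_q|exact: q01].
have I0 m : 0 <= \int[m]_x q x A by exact: integral_ge0.
have F m : \int[m]_x q x A \is a fin_num.
  by apply: integral_fin_num; [exact: measurable_q|exact: q01].
have i1 := Ile m1 (fun B mB => (mle B mB).1).
have i2 := Ile m2 (fun B mB => (mle B mB).2).
move: i1 i2 (I0 m1) (I0 m2).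
rewrite -(fineK (F m1)) -(fineK (F m2)) -(fineK (fin_num_measure mu A mA)).
rewrite -!(EFinM, EFinN, EFinD) !lee_fin => i1 i2 i3 i4.
by rewrite ler_norml; apply/andP; split; lra.
Qed.

Lemma kernel_image_contract rho rho' (c : {nonneg R}) (a e dl v : R) :
  (0 <= dl <= 1)%R ->
  (forall C, measurable C -> (2^-1)%:E <= mu C ->
     mu [set x | q x C < dl%:E] <= a%:E) ->
  (forall A, measurable A -> `|rho A| <= c%:num%:E * mu A + e%:E) ->
  rho setT = 0 -> (forall A, measurable A -> rho A <= v%:E) ->
  kernel_image rho rho' ->
  forall A, measurable A -> rho' A <= ((1 - dl) * v + dl * (c%:num * a + e))%:E.
Proof.
move=> /andP[dl0 dl1] minor H rhoT rhov im A mA.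
have [m1 [m2 [j12 ->]]] := im A mA.
have mle := jordan_decomposition_le j12 H.
have [P mP PE] := jordan_decompositionE j12.
have m1T := (PE _ measurableT).1; rewrite setTI in m1T.
have m1v : m1 setT <= v%:E by rewrite m1T; exact: rhov.
have m2T : m2 setT = m1 setT.
  move: rhoT; rewrite (j12.1 _ measurableT) => /eqP.
  by rewrite sube_eq ?fin_num_adde_defl ?fin_num_measure// add0e => /eqP.
have F m B : measurable B -> \int[m]_x q x B \is a fin_num.
  by move=> mB; apply: integral_fin_num; [exact: measurable_q|exact: q01].
have mAC : measurable (~` A) by exact: measurableC.
have i1 : \int[m1]_x q x A + \int[m1]_x q x (~` A) = m1 setT.
  rewrite -ge0_integralD//; [|exact: measurable_q..].
  rewrite -[RHS]mul1e -integral_cst//; apply: eq_integral => x _.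
  by rewrite -measureU ?setUv ?setICr//= qT.
have i2 : 0 <= \int[m2]_x q x A by exact: integral_ge0.
have i3 : 0 <= \int[m1]_x q x (~` A) by exact: integral_ge0.
have : dl%:E * (m1 setT - (c%:num * a + e)%:E) <= \int[m1]_x q x (~` A) \/
   dl%:E * (m1 setT - (c%:num * a + e)%:E) <= \int[m2]_x q x A.
  have [muA|muA] := leP (2^-1)%:E (mu A).
    right; rewrite -m2T; apply: integral_kernel_ge => //; last exact: minor.
    by move=> B mB; exact: (mle B mB).2.
  left; apply: integral_kernel_ge => //.
    by move=> B mB; exact: (mle B mB).1.
  apply: minor => //; rewrite probability_setC//.
  rewrite -(fineK (fin_num_measure mu A mA)) lte_fin in muA *.
  by rewrite -EFinD lee_fin; lra.
move: i1 i2 i3 m1v.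
rewrite -(fineK (F m1 A mA)) -(fineK (F m1 _ mAC)) -(fineK (F m2 A mA)).
rewrite -(fineK (fin_num_measure m1 _ measurableT)).
set x1 := fine _; set x2 := fine (\int[m1]_x q x (~` A)); set y := fine (\int[m2]_x _).
set s := fine _.
rewrite -!(EFinD, EFinN, EFinM) !lee_fin => -[i1] i2 i3 i4 i5.
have : (dl * (s - (c%:num * a + e)) <= x2 + y)%R by case: i5; lra.
by nra.
Qed.

(** This makes [r 1] absolutely continuous with respect to [mu], whatever the initial charge [r 0]
    is. *)
Lemma kernel_image_null rho rho' A : kernel_image rho rho' ->
  measurable A -> mu A = 0 -> rho' A = 0.
Proof.
move=> im mA muA; have [m1 [m2 [_ ->]]] := im A mA.
by rewrite !integral0_eq ?sube0// => x _; apply/(mu_equiv_q x mA).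
Qed.

Lemma kernel_image_setT rho rho' : kernel_image rho rho' ->
  rho' setT = rho setT.
Proof.
move=> im; have [m1 [m2 [j12 ->]]] := im _ measurableT.
have I (m : {finite_measure set T -> \bar R}) : \int[m]_x q x setT = m setT.
  rewrite -[RHS]mul1e -integral_cst//; apply: eq_integral => x _.
  exact: qT.
by rewrite !I (j12.1 _ measurableT).
Qed.

Theorem kernel_iterates_cvg0 (r : nat -> {charge set T -> \bar R}) :
  r 0%N setT = 0 -> (forall n, kernel_image (r n) (r n.+1)) ->
  tv_norm (r n) @[n --> \oo] --> 0.
Proof.
move=> r0T im.
have rT n : r n setT = 0 by elim: n => // n <-; exact: kernel_image_setT.
(* One [e] is the fixed point of the contraction, the other bounds the geometric remainder; the
   factor [2] comes from [tv_norm_le]. *)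
have bound (e : R) : (0 < e)%R ->
    \forall n \near \oo, tv_norm (r n) <= (2 * (e + e))%:E.
  move=> e0; have e20 : (0 < e / 2)%R by rewrite divr_gt0.
  have [c cr] : exists c : {nonneg R}, forall A, measurable A ->
      `|r 1%N A| <= c%:num%:E * mu A + (e / 2)%:E.
    by apply: charge_le_scale_add => // A; exact: kernel_image_null (im 0%N).
  have {}cr n : forall A, measurable A ->
      `|r n.+1 A| <= c%:num%:E * mu A + (e / 2)%:E.
    by elim: n => // n; exact: kernel_image_le (im n.+1).
  have c10 : (0 < c%:num + 1)%R by rewrite ltr_wpDl.
  (* [c] is already fixed for all [n], so [a] may depend on it; the choice gives
     [c * a + e / 2 <= e], and [+ 1] covers [c = 0]. *)
  have a0 : (0 < e / 2 / (c%:num + 1))%R by rewrite divr_gt0.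
  have [dl /andP[dl0 dl1] minor] := kernel_minorization a0.
  set a := (e / 2 / (c%:num + 1))%R in a0 minor.
  have cae : (c%:num * a + e / 2 <= e)%R.
    have : (a * (c%:num + 1) = e / 2)%R by rewrite /a divfK// gt_eqF.
    by nra.
  have [V [V0 rV]] := charge_bounded (r 1%N).
  (* The recursion [v -> (1 - dl) * v + dl * e] fixes [e] and shrinks the distance to it by the
     factor [1 - dl]. *)
  have key n : forall A, measurable A -> r n.+1 A <= (e + (1 - dl) ^+ n * V)%:E.
    elim: n => [A mA|n IH A mA].
      by apply: (le_trans (rV _ mA)); rewrite lee_fin expr0; lra.
    have dl01 : (0 <= dl <= 1)%R by rewrite ltW.
    apply: le_trans (kernel_image_contract dl01 minor (cr n)
      (rT n.+1) IH (im n.+1) mA) _.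
    by rewrite lee_fin exprS; nra.
  have : ((1 - dl) ^+ n * V)%R @[n --> \oo] --> (0 : R)%R.
    rewrite -[X in _ --> X](mul0r V); apply: cvgM; last exact: cvg_cst.
    by apply: cvg_expr; rewrite ltr_norml; lra.
  move=> /cvgrPdist_lt/(_ _ e0)[N _ HN].
  (* The estimate for [r n.+1] carries the exponent [n], hence the shift. *)
  exists N.+1 => // -[//|n] /= Nn.
  apply: tv_norm_le => // A mA; apply: (le_trans (key n A mA)).
  rewrite lee_fin lerD2l.
  have := HN n Nn; rewrite /= sub0r normrN => /ltW; apply: le_trans.
  exact: ler_norm.
apply/fine_cvgP; split.
  have := bound _ ltr01; apply: filterS => n h.
  by rewrite ge0_fin_numE ?tv_norm_ge0//; apply: (le_lt_trans h); rewrite ltry.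
apply/cvgrPdist_le => e e0.
have e40 : (0 < e / 4)%R by rewrite divr_gt0.
have := bound _ e40; apply: filterS => n h.
rewrite sub0r normrN /= ger0_norm; last by rewrite fine_ge0// tv_norm_ge0.
have F : tv_norm (r n) \is a fin_num.
  by rewrite ge0_fin_numE ?tv_norm_ge0//; apply: (le_lt_trans h); rewrite ltry.
by move: h; rewrite -{1}(fineK F) lee_fin; lra.
Qed.

End kernel.

(** * Reduction of the operator statement to kernels of finite measures *)

Theorem theorem4p5 (R : realType) (Omega : ptopologicalType)
  (Top : {charge set borel Omega -> \bar R} -> {charge set borel Omega -> \bar R})
  (k : borel Omega -> {charge set borel Omega -> \bar R}) :
  polish_space R Omega ->
  weakly_continuous_with_kernel Top k ->
  (forall x, k x setT = 1%E /\ forall A, measurable A -> (0 <= k x A)%E) ->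
  (forall x y A, measurable A -> (k x A = 0%E <-> k y A = 0%E)) ->
  forall mu : probability (borel Omega) R,
  (forall A, measurable A -> Top (charge_of_finite_measure mu) A = mu A) ->
  forall nu : {charge set borel Omega -> \bar R},
    tv_norm (fun A => (iter n Top nu A - nu setT * mu A)%E) @[n --> \oo] --> 0%E.
Proof.
move=> _ [[mk _] Topk] kprob kequiv mu muinv nu.
(* The charges [k x] are nonnegative; replacing them by finite measures makes the kernel results
   applicable. *)
have /choice[q qE] : forall x, exists m : {finite_measure set borel Omega -> \bar R},
    forall A, measurable A -> m A = k x A.
  by move=> x; apply: finite_measure_of_charge; exact: (kprob x).2.
have qkE A : measurable A -> (fun x => k x A : \bar R) = (fun x => q x A).
  by move=> mA; apply/funext => x; rewrite qE.
have measurable_q A : measurable A ->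
    measurable_fun setT (fun x => q x A : \bar R).
  by move=> mA; rewrite -qkE//; exact: mk.
have qT x : q x setT = 1%E by rewrite qE//; exact: (kprob x).1.
have q01 A : measurable A -> forall x, (0 <= q x A <= 1)%E.
  by move=> mA x; rewrite measure_ge0 -(qT x) le_measure ?inE.
have inv A : measurable A -> (\int[mu]_x q x A)%E = mu A.
  move=> mA; rewrite -muinv//.
  have [m1 [m2 [j12 ->]]] := Topk (charge_of_finite_measure mu) A mA.
  rewrite qkE//.
  (* The decomposition supplied for [mu] is not chosen, but nonnegativity forces it to be [mu] and
     [0] on measurable sets. *)
  have mE B : measurable B -> m1 B = mu B /\ m2 B = 0%E.
    by apply: (jordan_decomposition_ge0 _ j12) => C mC; exact: measure_ge0.
  have -> : (\int[m2]_x q x A)%E = 0%E.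
    apply/eqP; rewrite eq_le integral_ge0// andbT -(mE _ measurableT).2.
    by apply: integral_le_mass; [exact: measurable_q|exact: q01].
  rewrite sube0; apply: eq_measure_integral => B mB _.
  exact/esym/(mE B mB).1.
have mu_equiv_q x A : measurable A -> mu A = 0%E <-> q x A = 0%E.
  move=> mA; split=> [muA|qA]; last first.
    rewrite -inv// integral0_eq// => y _.
    by rewrite qE//; apply/(kequiv x y _ mA); rewrite -qE.
  (* By invariance [q y A] vanishes for [mu]-almost every [y]. If it were nonzero at [x],
     equivalence would make it nonzero everywhere, and the null set [N] would be the whole space. *)
  have /(ae_eq_integral_abs mu measurableT (measurable_q A mA))[N [mN muN0 subN]] :
      (\int[mu]_x `|q x A| = 0)%E.
    by under eq_integral do rewrite gee0_abs//; rewrite inv.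
  apply: contrapT => qx0; have NT : N = setT.
    apply/seteqP; split => // y _; apply: subN => /= /(_ I) qy0; apply: qx0.
    by rewrite qE//; apply/(kequiv y x _ mA); rewrite -qE.
  have muN1 : mu N = 1%E by rewrite NT probability_setT.
  by have /eqP := etrans (esym muN1) muN0; rewrite onee_eq0.
pose t := fine (nu setT).
have tE : nu setT = t%:E by rewrite fineK// fin_num_measure.
pose rho n : {charge set borel Omega -> \bar R} :=
  cadd (iter n Top nu) (cscale (- t) (charge_of_finite_measure mu)).
have rhoE n A : rho n A = (iter n Top nu A - nu setT * mu A)%E.
  change (iter n Top nu A + (- t)%:E * mu A = iter n Top nu A - nu setT * mu A)%E.
  by rewrite tE EFinN mulNe.
rewrite (_ : (fun n => _) = (fun n => tv_norm (rho n))); last first.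
  by apply/funext => n; congr tv_norm; apply/funext => A; rewrite rhoE.
apply: (kernel_iterates_cvg0 measurable_q qT mu_equiv_q inv).
  by rewrite rhoE /= probability_setT mule1 subee// fin_num_measure.
(* Writing [mu A] as the integral of [q x A] turns the subtracted term into its own image; linearity
   comes from the kernel formula. *)
move=> n A mA; rewrite rhoE tE -(inv A mA).
apply: signed_integral_sub; [exact: measurable_q|exact: q01|].
by rewrite -qkE//; exact: Topk.
Qed.
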